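(* Let $n\ge1$. (a) The interval $I=[(0,\ldots,0),(n,n-1,\ldots,1)]$ in the Young lattice decomposes into pairwise disjoint subintervals as $$I=\bigcup_{k=0}^n\ \bigcup_{0=i_0<i_1<\dots<i_k<i_{k+1}=n+1}\big[\lambda^m_{i_1,\dots,i_k},\lambda^M_{i_1,\dots,i_k}\big],$$ where, with exponents denoting repetition of parts, $$\lambda^M_{i_1,\ldots,i_k}=\left(i_k^{\,n-i_k+1},\,i_{k-1}^{\,i_k-i_{k-1}},\ldots,i_1^{\,i_2-i_1},\,0^{\,i_1-1}\right),$$ $$\lambda^m_{i_1,\ldots,i_k}=\left(i_k,\,i_{k-1}^{\,n-i_k+1},\,i_{k-2}^{\,i_k-i_{k-1}},\ldots,i_1^{\,i_3-i_2},\,0^{\,i_2-2}\right).$$ (b) Let $\mathfrak i\in\mathcal I^n$ be an ideal with corresponding partition $\lambda$. If $\lambda\in[\lambda^m_{i_1,\dots,i_k},\lambda^M_{i_1,\dots,i_k}]$, then the class of nilpotence of $\mathfrak i$ is equal to $k$.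
   Context: The Young lattice is the set of partitions ordered by inclusion of Ferrers diagrams. For $k=0$ both $\lambda^m$ and $\lambda^M$ are the zero partition $(0^n)$; for $k=1$ (so $i_2=n+1$) $\lambda^m_{i_1}=(i_1,0^{n-1})$ and $\lambda^M_{i_1}=(i_1^{\,n-i_1+1},0^{\,i_1-1})$. Let $\mathfrak g=sl(n+1,\mathbb C)$ with a fixed Cartan subalgebra $\mathfrak h$, positive roots $\Delta^+$, simple roots $\alpha_1,\dots,\alpha_n$ (numbered along the Dynkin diagram of type $A_n$), root spaces $\mathfrak g_\alpha$, and Borel subalgebra $\mathfrak b=\mathfrak h\oplus\bigoplus_{\alpha\in\Delta^+}\mathfrak g_\alpha$. $\mathcal I^n$ is the set of ad-nilpotent ideals of $\mathfrak b$, i.e. ideals of $\mathfrak b$ consisting of ad-nilpotent elements. Each $\mathfrak i\in\mathcal I^n$ has the form $\mathfrak i=\bigoplus_{\alpha\in\Phi}\mathfrak g_\alpha$ for some $\Phi\subseteq\Delta^+$. Correspondence with partitions: write the positive roots as $\tau_{ij}=\alpha_i+\alpha_{i+1}+\dots+\alpha_{n-j+1}$, $1\le i\le n$, $1\le j\le n-i+1$, and identify $\tau_{ij}$ with the cell $(i,j)$ (row $i$, column $j$) of the staircase Ferrers diagram $(n,n-1,\dots,1)$. The cells corresponding to the roots in $\Phi$ form the Ferrers diagram of a partition $\lambda$ contained in $(n,n-1,\dots,1)$; this gives a bijection between $\mathcal I^n$ and the partitions contained in $(n,n-1,\dots,1)$. Class of nilpotence: put $\mathfrak i^1=\mathfrak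 i$, $\mathfrak i^{m}=[\mathfrak i^{m-1},\mathfrak i]$. The class of nilpotence of $\mathfrak i$ is the smallest $m\ge0$ with $\mathfrak i^{m+1}=0$ (so the zero ideal has class $0$, and Abelian ideals are exactly those of class at most $1$). *)

(* Defs.v *)
From HB Require Import structures.
From mathcomp Require Import all_boot all_order all_algebra.
From mathcomp Require Import complex.
From mathcomp Require Import boolp classical_sets reals.

Set Implicit Arguments.
Unset Strict Implicit.
Unset Printing Implicit Defensive.

Import Order.TTheory GRing.Theory Num.Theory.

Local Open Scope classical_set_scope.
Local Open Scope nat_scope.

(* A partition is the function sending a row index, counted from 0, to the
   length of that row; a list of parts s stands for the function nth 0 s, so
   lists differing only by trailing zeros give the same partition. *)

Definition is_partition (l : nat -> nat) : Prop :=
  (forall i, l i.+1 <= l i) /\ (exists N, forall i, N <= i -> l i = 0).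

Definition young_le (l m : nat -> nat) : Prop := forall i, l i <= m i.

Definition young_itv (a b : seq nat) : set (nat -> nat) :=
  [set l | [/\ is_partition l, young_le (nth 0 a) l & young_le l (nth 0 b)]].

Definition staircase (n : nat) : seq nat := rev (iota 1 n).

(* The lists [:: i_1; ...; i_k] with 0 = i_0 < i_1 < ... < i_k < i_(k+1) = n+1. *)
Definition chains (n k : nat) : set (seq nat) :=
  [set s | size s = k /\ path ltn 0 (rcons s n.+1)].

(* The index i_j, for 0 <= j <= k+1. *)
Definition idx (n : nat) (s : seq nat) (j : nat) : nat :=
  nth 0 (0 :: rcons s n.+1) j.

(* For k = 0 this is (0^n), since then i_1 = n+1. *)
Definition lambda_max (n : nat) (s : seq nat) : seq nat :=
  let i := idx n s in
  flatten [seq nseq (i j.+1 - i j) (i j) | j <- rev (iota 1 (size s))]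
    ++ nseq (i 1 - 1) 0.

Definition lambda_min (n : nat) (s : seq nat) : seq nat :=
  let i := idx n s in
  if size s is k'.+1 then
    i k'.+1 :: flatten [seq nseq (i j.+2 - i j.+1) (i j) | j <- rev (iota 1 k')]
      ++ nseq (i 2 - 2) 0
  else nseq n 0.

Local Open Scope ring_scope.

Section SpecialLinear.
Variables (F : fieldType) (n : nat).
Local Notation gl := 'M[F]_n.+1.

Definition lie (x y : gl) : gl := x *m y - y *m x.

Lemma lie_is_linear (x : gl) : linear (lie x).
Proof.
move=> c y z; rewrite /lie mulmxDr mulmxDl -scalemxAr -scalemxAl scalerBr.
by rewrite opprD addrACA.
Qed.

HB.instance Definition _ (x : gl) :=
  GRing.isLinear.Build F gl gl _ (lie x) (lie_is_linear x).

Definition ad (x : gl) : 'End(gl) := linfun (lie x).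

Definition sl : {vspace gl} := lker (linfun (fun x : gl => \tr x : F^o)).

(* [U, V]: by bilinearity, brackets of basis vectors span it. *)
Definition lie_space (U V : {vspace gl}) : {vspace gl} :=
  <<[seq lie x y | x <- vbasis U, y <- vbasis V]>>%VS.

Definition ad_diagonalizable (t : gl) : Prop :=
  exists2 X : seq gl, basis_of sl X &
    forall x, x \in X -> exists c : F, lie t x = c *: x.

(* Cartan subalgebras of a complex semisimple Lie algebra: Abelian,
   self-centralizing subalgebras whose elements are ad-diagonalizable. *)
Definition is_cartan (h : {vspace gl}) : Prop :=
  [/\ (h <= sl)%VS,
      forall x y, x \in h -> y \in h -> lie x y = 0,
      forall x, x \in sl -> (forall t, t \in h -> lie t x = 0) -> x \in h
    & forall t, t \in h -> ad_diagonalizable t].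

Section Roots.
Variable h : {vspace gl}.

Definition cartan_dual := 'Hom(subvs_of h, F^o).

(* The x in sl with [t, x] = b(t) x for all t in h; by linearity it is enough
   to let t range over a basis of h. *)
Definition root_space (b : cartan_dual) : {vspace gl} :=
  (sl :&: \bigcap_(t <- vbasis {:subvs_of h}) lker (ad (vsval t) - b t *: \1%VF))%VS.

Definition is_root (b : cartan_dual) : bool :=
  (b != 0) && (root_space b != 0%VS).

(* The simple root alpha_(i+1) is a`_i. *)
Variable a : n.-tuple cartan_dual.

Definition nonneg_comb (b : cartan_dual) : Prop :=
  exists c : 'I_n -> nat, b = \sum_(i < n) a`_i *+ c i.

Definition is_simple_system : Prop :=
  [/\ basis_of fullv a,
      forall b, b \in a -> is_root b
    & forall b, is_root b -> nonneg_comb b \/ nonneg_comb (- b)].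

(* Two distinct simple roots are joined in the Dynkin diagram iff their sum is
   a root; all edges are simple for sl. *)
Definition numbered_along_dynkin : Prop :=
  forall i j, (i < j < n)%N -> is_root (a`_i + a`_j) = (j == i.+1).

Definition is_positive_root (b : cartan_dual) : Prop :=
  is_root b /\ nonneg_comb b.

Definition is_borel (b : {vspace gl}) : Prop :=
  exists2 D : seq cartan_dual, (forall r, r \in D <-> is_positive_root r) &
    b = (h + \sum_(r <- D) root_space r)%VS.

(* The root of the cell in row i and column j, both counted from 0, for
   i + j < n: alpha_(i+1) + ... + alpha_(n-j). *)
Definition tau (i j : nat) : cartan_dual := \sum_(i <= k < n - j) a`_k.

Definition corresponds (I : {vspace gl}) (l : nat -> nat) : Prop :=
  young_itv (nseq n 0%N) (staircase n) l /\
  I = (\sum_(i < n) \sum_(j < l i) root_space (tau i j))%VS.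

End Roots.

Definition ad_nilpotent (x : gl) : Prop :=
  exists m, forall y, y \in sl -> iter m (lie x) y = 0.

Definition is_ad_nilpotent_ideal (b I : {vspace gl}) : Prop :=
  [/\ (I <= b)%VS,
      forall x y, x \in b -> y \in I -> lie x y \in I
    & forall x, x \in I -> ad_nilpotent x].

(* I^(m+1), with I^1 = I and I^m = [I^(m-1), I]. *)
Definition lower_central (I : {vspace gl}) (m : nat) : {vspace gl} :=
  iter m (fun J => lie_space J I) I.

Definition nilpotence_class_is (I : {vspace gl}) (k : nat) : Prop :=
  lower_central I k = 0%VS /\
  forall m, lower_central I m = 0%VS -> (k <= m)%N.

End SpecialLinear.

(* Main.v *)
Require Import Defs.
From HB Require Import structures.
From mathcomp Require Import all_boot all_order all_algebra.
From mathcomp Require Import complex spectral zify ring.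
From mathcomp Require Import boolp classical_sets reals.

(* A partition l lies in the interval of i_1 < ... < i_k iff, with rows counted
   from 0, l(n+1 - i_(j+1)) = i_j for all j <= k. So the chain is the orbit of
   n+1 under f x = l(n+1 - x), and f x < x when l is contained in the staircase;
   this gives the decomposition.
   For the nilpotence class, h is simultaneously diagonalizable, so the roots are
   the differences eps_p - eps_q of diagonal entries, and the simple roots are
   the successive differences along a path through all n+1 indices, up to a
   common sign. The ideal is then spanned by matrix units e_pq with q >= g p,
   where g p = n+1 - l p, and its m-th power contains e_0q exactly for
   q >= g^m 0. As g^j 0 = n+1 - i_(k+1-j), the class is k. *)

Set Implicit Arguments.
Unset Strict Implicit.
Unset Printing Implicit Defensive.

Import Order.TTheory GRing.Theory Num.Theory.

Local Open Scope classical_set_scope.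
Local Open Scope ring_scope.

(** * Decomposition of the Young interval *)

Section Blocks.
Local Open Scope nat_scope.
Variables I V : nat -> nat.

(** The common shape of both extreme partitions: [lambda_max] has [I] and [V] both equal to the
    chain, and the tail of [lambda_min] after its first part has [I] shifted by one. *)
Definition blocks (k : nat) : seq nat :=
  flatten [seq nseq (I j.+1 - I j) (V j) | j <- rev (iota 1 k)].

Lemma blocksS k : blocks k.+1 = nseq (I k.+2 - I k.+1) (V k.+1) ++ blocks k.
Proof. by rewrite /blocks -[X in rev (iota 1 X)]addn1 iotaD rev_cat add1n. Qed.

Hypothesis I_mono : {homo I : i j / i <= j}.

(** The block lengths telescope: the blocks above block [j] fill [I k.+1 - I j.+1] rows in all. *)
Lemma nth_blocks k c j r : 0 < j <= k -> I k.+1 - I j.+1 <= r < I k.+1 - I j ->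
  nth 0 (blocks k ++ nseq c 0) r = V j.
Proof.
elim: k r => [|k IHk] r; first by case: j.
rewrite blocksS -catA nth_cat size_nseq nth_nseq => /andP[j0 jk] /andP[le_r lt_r].
have mon1 := I_mono (leqnSn k.+1).
have [jk1|jk1] := eqVneq j k.+1; first by subst j; rewrite lt_r.
have jk' : j <= k by lia.
have monj : I j.+1 <= I k.+1 by apply: I_mono.
by rewrite ltnNge (leq_trans _ le_r) ?leq_sub2l //= IHk ?j0 //; lia.
Qed.

Lemma nth_blocks0 k c r : I k.+1 - I 1 <= r -> nth 0 (blocks k ++ nseq c 0) r = 0.
Proof.
elim: k r => [|k IHk] r le_r.
  by rewrite /blocks /= nth_nseq if_same.
rewrite blocksS -catA nth_cat size_nseq.
have mon1 : I 1 <= I k.+1 by apply: I_mono.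
have mon2 := I_mono (leqnSn k.+1).
by rewrite ltnNge (leq_trans _ le_r) ?leq_sub2l //= IHk; lia.
Qed.

(** The index [j = 0] stands for the rows past the last block; these are zero, in agreement with
    [V 0 = 0]. In general [j] is the least index whose block starts at or above row [r]. *)
Lemma nth_blocksP k c r : V 0 = 0 -> 0 < I k.+1 -> exists2 j, j <= k &
  [/\ I k.+1 - I j.+1 <= r, (0 < j -> r < I k.+1 - I j) &
      nth 0 (blocks k ++ nseq c 0) r = V j].
Proof.
move=> V0 I0.
have [le_r|lt_r] := leqP (I k.+1 - I 1) r.
  by exists 0 => //; split => //; rewrite V0 nth_blocks0.
have ex : exists j, I k.+1 - I j.+1 <= r by exists k; rewrite subnn.
have [j le_j min_j] := ex_minnP ex.
have jk : j <= k by apply: min_j; rewrite subnn.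
have [j0|j0] := posnP j; first by move: le_j; rewrite j0; lia.
have lt_j : r < I k.+1 - I j.
  rewrite ltnNge; apply/negP => le.
  by have := min_j j.-1; rewrite prednK // => /(_ le); lia.
by exists j => //; split => //; rewrite (@nth_blocks k c j) ?j0 // le_j.
Qed.

Lemma blocks_nonincreasing k c r : V 0 = 0 -> 0 < I k.+1 ->
  {homo V : i j / i <= j} ->
  nth 0 (blocks k ++ nseq c 0) r.+1 <= nth 0 (blocks k ++ nseq c 0) r.
Proof.
move=> V0 I0 V_mono.
have [j jk [le_r lt_r ->]] := @nth_blocksP k c r V0 I0.
have [j' jk' [le_r' lt_r' ->]] := @nth_blocksP k c r.+1 V0 I0.
apply: V_mono; rewrite leqNgt; apply/negP => jj'.
have := lt_r' (leq_ltn_trans (leq0n _) jj').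
by have := I_mono jj'; lia.
Qed.

End Blocks.

(** * Chains, membership in their intervals, and orbits *)

Section Chains.
Local Open Scope nat_scope.
Implicit Types (l : nat -> nat) (s : seq nat) (n : nat).

Lemma partition_nonincreasing l : is_partition l -> {homo l : i j / i <= j >-> j <= i}.
Proof.
move=> [ld _] i j ij; rewrite -(subnKC ij).
by elim: (j - i) => [|d IHd]; rewrite ?addn0 // addnS; apply: leq_trans IHd.
Qed.

Lemma nth_staircase n r : nth 0 (staircase n) r = n - r.
Proof.
rewrite /staircase; have [le|lt] := leqP n r.
  by rewrite nth_default ?size_rev ?size_iota //; lia.
by rewrite nth_rev ?size_iota // nth_iota; lia.
Qed.

Section OneChain.
Variables (n : nat) (s : seq nat).
Hypothesis s_path : path ltn 0 (rcons s n.+1).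
Local Notation k := (size s).
Local Notation idx := (idx n s).

Lemma idx0 : idx 0 = 0. Proof. by []. Qed.

Lemma idxk1 : idx k.+1 = n.+1.
Proof. by rewrite /Defs.idx /= nth_rcons ltnn eqxx. Qed.

Lemma idx_lt j : j <= k -> idx j < idx j.+1.
Proof.
move=> jk; have /(pathP 0) := s_path; rewrite size_rcons => /(_ j); apply.
by rewrite ltnS.
Qed.

Lemma idx_le i j : i <= j -> j <= k.+1 -> idx i <= idx j.
Proof.
move=> ij; rewrite -(subnKC ij); elim: (j - i) => [|d IHd]; rewrite ?addn0 //.
rewrite addnS ltnS => dk; apply: leq_trans (IHd (leqW dk)) _.
exact/ltnW/idx_lt.
Qed.

Lemma idx_gt0 j : 0 < j <= k.+1 -> 0 < idx j.
Proof.
by move=> /andP[j0 jk]; apply: leq_trans (idx_le j0 jk); apply: (@idx_lt 0).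
Qed.

Lemma idx_le_n j : j <= k -> idx j <= n.
Proof.
move=> jk; rewrite -ltnS -idxk1; apply: leq_trans (idx_lt jk) _.
exact: idx_le.
Qed.

Lemma leq_idx j : j <= k.+1 -> j <= idx j.
Proof.
elim: j => // j IHj jk; apply: leq_ltn_trans (IHj (leqW _)) (idx_lt _) => //.
Qed.

Lemma chain_size : k <= n.
Proof. by have := leq_idx (leqnn k.+1); rewrite idxk1 ltnS. Qed.

(* [idx] is increasing only up to index k+1; beyond it is the junk value 0. *)
Definition idx_sat j := idx (minn j k.+1).

Lemma idx_satE j : j <= k.+1 -> idx_sat j = idx j.
Proof. by rewrite /idx_sat => /minn_idPl ->. Qed.

Lemma idx_sat_mono : {homo idx_sat : i j / i <= j}.
Proof. by move=> i j ij; apply: idx_le; rewrite ?geq_minr //; lia. Qed.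

Lemma lambda_maxE : lambda_max n s = blocks idx_sat idx_sat k ++ nseq (idx 1 - 1) 0.
Proof.
congr (flatten _ ++ _); apply/eq_in_map => j; rewrite mem_rev mem_iota => jk.
by rewrite !idx_satE //; lia.
Qed.

Lemma lambda_minE : 0 < k -> lambda_min n s =
  idx k :: blocks (fun j => idx_sat j.+1) idx_sat k.-1 ++ nseq (idx 2 - 2) 0.
Proof.
rewrite /lambda_min; case E: (size s) => [//|k'] _ /=.
congr (_ :: flatten _ ++ _); apply/eq_in_map => j; rewrite mem_rev mem_iota => jk.
by rewrite !idx_satE ?E //; lia.
Qed.

Let idx_sat_k1 : idx_sat k.+1 = n.+1.
Proof. by rewrite idx_satE ?idxk1. Qed.

Lemma nth_lambda_maxP r : exists2 j, j <= k &
  [/\ n.+1 - idx j.+1 <= r, (0 < j -> r < n.+1 - idx j) &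
      nth 0 (lambda_max n s) r = idx j].
Proof.
have := @nth_blocksP _ idx_sat idx_sat_mono k (idx 1 - 1) r (idx_satE (leq0n _)).
rewrite lambda_maxE idx_sat_k1 => -[] // j jk.
have jk1 := leqW jk.
by rewrite !idx_satE // => ?; exists j.
Qed.

(** Row [n.+1 - idx j.+1] is the first row of the block of value [idx j]. *)
Lemma nth_lambda_max j : j <= k -> nth 0 (lambda_max n s) (n.+1 - idx j.+1) = idx j.
Proof.
move=> jk; have [j' jk' [le_r lt_r ->]] := nth_lambda_maxP (n.+1 - idx j.+1).
have [lt|lt|->//] := ltngtP j j'.
  have /lt_r : 0 < j' by lia.
  by have := idx_le lt (leqW jk'); lia.
have := @idx_le j'.+1 j lt (leqW jk); have := idx_lt jk.
have := @idx_le j.+1 k.+1; rewrite idxk1 => /(_ jk (leqnn _)).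
lia.
Qed.

Lemma nth_lambda_minP r : 0 < k -> exists2 j, j < k &
  [/\ n.+1 - idx j.+2 <= r, (0 < j -> r < n.+1 - idx j.+1) &
      nth 0 (lambda_min n s) r.+1 = idx j].
Proof.
move=> k0; have mon : {homo (fun j => idx_sat j.+1) : i j / i <= j}.
  by move=> i j ij; apply: idx_sat_mono.
have := @nth_blocksP _ idx_sat mon k.-1 (idx 2 - 2) r (idx_satE (leq0n _)).
rewrite lambda_minE // prednK // idx_sat_k1 => -[] // j jk.
have jk' : j < k by lia.
have [jk1 jk2] : j.+1 <= k.+1 /\ j <= k.+1 by lia.
by rewrite /= !idx_satE // => ?; exists j.
Qed.

Lemma nth_lambda_min0 : nth 0 (lambda_min n s) 0 = idx k.
Proof.
have [k0|k0] := posnP k; last by rewrite lambda_minE.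
by rewrite k0 idx0 (size0nil k0) /lambda_min /= nth_nseq if_same.
Qed.

(** The same row as for [lambda_max], but for [j > 0] it is here the last one of value [idx j],
    because the first part [idx k] pushes every block one row down. *)
Lemma nth_lambda_min j : j <= k -> nth 0 (lambda_min n s) (n.+1 - idx j.+1) = idx j.
Proof.
rewrite leq_eqVlt => /predU1P[->|jk].
  by rewrite idxk1 subnn nth_lambda_min0.
have k0 : 0 < k by lia.
have := idx_le_n jk => le_n.
have -> : n.+1 - idx j.+1 = (n - idx j.+1).+1 by lia.
have [j' jk' [le_r lt_r ->]] := nth_lambda_minP (n - idx j.+1) k0.
have [lt|lt|->//] := ltngtP j j'.
  have /lt_r : 0 < j' by lia.
  by have := @idx_le j.+2 j'.+1 lt (leqW jk'); have := idx_lt jk; lia.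
have := @idx_le j'.+2 j.+1 lt (leqW jk).
lia.
Qed.

Lemma lambda_max_partition : is_partition (nth 0 (lambda_max n s)).
Proof.
split=> [i|].
  rewrite lambda_maxE; apply: blocks_nonincreasing => //; last exact: idx_sat_mono.
    exact: idx_sat_mono.
  by rewrite idx_sat_k1.
by exists (size (lambda_max n s)) => i; apply: nth_default.
Qed.

Lemma lambda_min_partition : is_partition (nth 0 (lambda_min n s)).
Proof.
split; last by exists (size (lambda_min n s)) => i; apply: nth_default.
have [k0|k0] := posnP k.
  by move=> i; rewrite (size0nil k0) /lambda_min /= !nth_nseq !if_same.
have mon : {homo (fun j => idx_sat j.+1) : i j / i <= j}.
  by move=> i j ij; apply: idx_sat_mono.
case=> [|i].
  have [j jk [_ _ ->]] := nth_lambda_minP 0 k0.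
  by rewrite nth_lambda_min0 idx_le // ltnW.
rewrite lambda_minE //=; apply: blocks_nonincreasing => //; last exact: idx_sat_mono.
by rewrite prednK ?idx_sat_k1.
Qed.

(** The two bounds agree at the rows [n.+1 - idx j.+1], which forces [l] there. Conversely, blocks
    of [lambda_max] start at such rows and nonzero blocks of [lambda_min] end at them, so
    monotonicity of [l] yields both bounds everywhere. *)
Lemma young_itvP l : is_partition l ->
  young_itv (lambda_min n s) (lambda_max n s) l <->
  forall j, j <= k -> l (n.+1 - idx j.+1) = idx j.
Proof.
move=> lP; split=> [[_ le_min le_max] j jk|lE].
  apply/eqP; rewrite eqn_leq -{1}(nth_lambda_max jk) le_max.
  by rewrite -{1}(nth_lambda_min jk) le_min.
have ld := partition_nonincreasing lP.
split=> // r.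
  case: r => [|r]; first by rewrite nth_lambda_min0 -lE ?idxk1 ?subnn.
  have [k0|k0] := posnP k.
    by rewrite (size0nil k0) /lambda_min /= nth_nseq if_same.
  have [j jk [le_r lt_r ->]] := nth_lambda_minP r k0.
  have [->//|j0] := posnP j.
  by rewrite -lE ?ld ?lt_r // ltnW.
have [j jk [le_r lt_r ->]] := nth_lambda_maxP r.
by rewrite -lE // ld.
Qed.

Lemma young_le_lambda : young_le (nth 0 (lambda_min n s)) (nth 0 (lambda_max n s)).
Proof.
(* [lambda_max] meets the membership criterion, hence lies in the interval and so above
   [lambda_min]. *)
by have [_] := (young_itvP lambda_max_partition).2 nth_lambda_max.
Qed.

Lemma lambda_max_staircase :
  young_le (nth 0 (lambda_max n s)) (nth 0 (staircase n)).
Proof.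
move=> r; rewrite nth_staircase.
have [j jk [le_r lt_r ->]] := nth_lambda_maxP r.
have [->//|/lt_r] := posnP j.
lia.
Qed.

End OneChain.

(* The points i_(k+1) = n+1, i_k, ..., i_0 = 0 form the orbit of n+1 under f,
   which stops when it first reaches 0. *)
Definition is_orbit (f : nat -> nat) x s :=
  path ltn 0 (rcons s x) /\
  forall j, j <= size s -> f (nth 0 (0 :: rcons s x) j.+1) = nth 0 (0 :: rcons s x) j.

Lemma orbit_nil f x : is_orbit f x [::] <-> 0 < x /\ f x = 0.
Proof.
split=> [[/=]|[x0 fx]]; first by rewrite andbT => x0 /(_ 0 isT).
by split=> [|[]//]; rewrite /= x0.
Qed.

(** A chain increases while the orbit descends, so its last entry is the first iterate [f x].
    Removing it leaves an orbit of a smaller point, on which existence and uniqueness proceed by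
    induction. *)
Lemma orbit_rcons f x s y : is_orbit f x (rcons s y) <->
  [/\ is_orbit f y s, y < x & f x = y].
Proof.
have nthE j : j <= (size s).+1 ->
    nth 0 (0 :: rcons (rcons s y) x) j = nth 0 (0 :: rcons s y) j.
  move=> js; rewrite -[0 :: rcons (rcons s y) x]/(rcons (0 :: rcons s y) x).
  by rewrite nth_rcons /= size_rcons ltnS js.
have nth_last : nth 0 (0 :: rcons (rcons s y) x) (size s).+2 = x.
  by rewrite /= nth_rcons size_rcons ltnn eqxx.
have nth_y : nth 0 (0 :: rcons s y) (size s).+1 = y.
  by rewrite /= nth_rcons ltnn eqxx.
rewrite /is_orbit rcons_path last_rcons size_rcons.
split=> [[/andP[sP yx] fE]|[[sP fE] yx fx]].
  split=> //; last by have := fE _ (leqnn _); rewrite nth_last nthE // nth_y.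
  by split=> // j js; have := fE j (leqW js); rewrite !nthE // leqW.
split; first by rewrite sP.
move=> j; rewrite leq_eqVlt => /predU1P[->|js]; first by rewrite nth_last nthE // nth_y.
by rewrite !nthE ?fE // ltnW.
Qed.

Lemma orbit_exists f x : 0 < x -> (forall y, 0 < y <= x -> f y < y) ->
  exists s, is_orbit f x s.
Proof.
elim/ltn_ind: x => x IHx x0 f_lt.
have [fx0|fx0] := posnP (f x); first by exists [::]; apply/orbit_nil.
have lt : f x < x by rewrite f_lt // x0 leqnn.
have [|s sP] := IHx _ lt fx0; last by exists (rcons s (f x)); apply/orbit_rcons.
by move=> y /andP[y0 le]; apply: f_lt; rewrite y0 (leq_trans le) // ltnW.
Qed.

Lemma orbit_gt0 f x s : is_orbit f x s -> 0 < x.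
Proof.
by case/lastP: s => [|s y] => [/orbit_nil[]|/orbit_rcons[_ /(leq_trans _) -> //]].
Qed.

Lemma orbit_unique f x s t : is_orbit f x s -> is_orbit f x t -> s = t.
Proof.
elim/last_ind: s x t => [|s y IHs] x t.
  move=> /orbit_nil[_ fx]; case/lastP: t => // t z /orbit_rcons[tP _ ].
  by rewrite fx => z0; have := orbit_gt0 tP; rewrite -z0.
move=> /orbit_rcons[sP _ fx]; case/lastP: t => [/orbit_nil[_]|t z /orbit_rcons[tP _]].
  by rewrite fx => y0; have := orbit_gt0 sP; rewrite y0.
by rewrite fx => yz; rewrite -yz in tP *; rewrite (IHs _ _ sP tP).
Qed.

Lemma young_itv_orbit n s l : path ltn 0 (rcons s n.+1) ->
  young_itv (lambda_min n s) (lambda_max n s) l <->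
  is_partition l /\ is_orbit (fun x => l (n.+1 - x)) n.+1 s.
Proof.
move=> sP; split=> [li|[lP [_ lE]]]; last by apply/young_itvP.
have lP : is_partition l by case: li.
by split=> //; split=> //; apply/young_itvP.
Qed.

Lemma young_itv_decomposition n :
  young_itv (nseq n 0) (staircase n) =
    \bigcup_(k in [set k : nat | k <= n]) \bigcup_(s in chains n k)
      young_itv (lambda_min n s) (lambda_max n s).
Proof.
apply/seteqP; split=> [l [lP _ l_le]|l [k kn [s [sk sP] [lP _ l_le]]]]; last first.
  split=> // r; first by rewrite nth_nseq if_same.
  exact: leq_trans (l_le r) (lambda_max_staircase sP r).
have [|s sO] := @orbit_exists (fun x => l (n.+1 - x)) n.+1 isT.
  (* The staircase gives [l (n.+1 - y) <= y - 1]. *)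
  move=> y /andP[y0 yn]; have := l_le (n.+1 - y); rewrite nth_staircase; lia.
have [sP _] := sO.
exists (size s); first exact: (chain_size sP).
by exists s => //; apply/young_itv_orbit.
Qed.

Lemma young_itv_trivIset n :
  trivIset (\bigcup_(k in [set k : nat | k <= n]) chains n k)
    (fun s => young_itv (lambda_min n s) (lambda_max n s)).
Proof.
move=> s t [_ _ [_ sP]] [_ _ [_ tP]] [l [/(young_itv_orbit _ sP)[_ sO]]].
move=> /(young_itv_orbit _ tP)[_ tO]; exact: orbit_unique sO tO.
Qed.

End Chains.

(** * Brackets of root vectors *)

Section LieBracket.
Variables (F : fieldType) (n : nat).
Local Notation gl := 'M[F]_n.+1.
Implicit Types (x y z : gl) (U V W : {vspace gl}).

Lemma lieC x y : lie x y = - lie y x.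
Proof. by rewrite /lie opprB. Qed.

Lemma lieZl c x y : lie (c *: x) y = c *: lie x y.
Proof. by rewrite lieC linearZ /= -scalerN -lieC. Qed.

Lemma lie_eq0 x y : lie x y = 0 -> x *m y = y *m x.
Proof. by move/eqP; rewrite subr_eq0 => /eqP. Qed.

(** Bilinearity in two steps: the preimage of [W] under a bracket map is a subspace, so it contains
    a span as soon as it contains the generators. *)
Lemma lie_span_mem (X Y : seq gl) W x y :
  (forall u v, u \in X -> v \in Y -> lie u v \in W) ->
  x \in <<X>>%VS -> y \in <<Y>>%VS -> lie x y \in W.
Proof.
move=> XYW xX yY.
have uP u : u \in X -> lie u y \in W.
  move=> uX; have /span_subvP sub : {subset Y <= (linfun (lie u) @^-1: W)%VS}.
    by move=> v vY; rewrite -memv_preim lfunE /= XYW.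
  by have := subvP sub _ yY; rewrite -memv_preim lfunE.
have /span_subvP sub : {subset X <= (linfun (lie y) @^-1: W)%VS}.
  by move=> u uX; rewrite -memv_preim lfunE /= lieC memvN uP.
by have := subvP sub _ xX; rewrite -memv_preim lfunE /= lieC memvN.
Qed.

Lemma memv_lie_space U V x y : x \in U -> y \in V -> lie x y \in lie_space U V.
Proof.
rewrite -{1}(span_basis (vbasisP U)) -{1}(span_basis (vbasisP V)).
by apply: lie_span_mem => u v uU vV; apply/memv_span/allpairs_f.
Qed.

Lemma lie_space_subv U V W :
  (forall x y, x \in U -> y \in V -> lie x y \in W) -> (lie_space U V <= W)%VS.
Proof.
move=> UVW; apply/span_subvP => _ /allpairsP[[u v] /= [uU vV ->]].
by apply: UVW; apply: vbasis_mem.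
Qed.

Lemma mem_sl x : (x \in sl F n) = (\tr x == 0).
Proof. by rewrite memv_ker lfunE. Qed.

Lemma memv_bigcap_seq (I : eqType) (r : seq I) (Us : I -> {vspace gl}) x :
  reflect (forall i, i \in r -> x \in Us i) (x \in \bigcap_(i <- r) Us i)%VS.
Proof.
elim: r => [|i r IHr]; first by rewrite big_nil memvf; left.
rewrite big_cons memv_cap; apply: (iffP andP) => [[xi /IHr xr] j|xU].
  by rewrite inE => /predU1P[->|/xr].
by split; [|apply/IHr => j jr]; rewrite xU // inE ?eqxx ?jr ?orbT.
Qed.

Lemma mem_root_spaceP (h : {vspace gl}) (b : cartan_dual h) x :
  reflect (x \in sl F n /\ forall t : subvs_of h, lie (vsval t) x = b t *: x)
          (x \in root_space b).
Proof.
have kerE (t : subvs_of h) :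
    (x \in lker (ad (vsval t) - b t *: \1%VF)) = (lie (vsval t) x == b t *: x).
  by rewrite memv_ker !lfun_simp subr_eq0.
rewrite /root_space memv_cap; apply: (iffP andP) => -[xs xb]; split=> //.
  move=> t; have [u ->] : exists u,
      t = \sum_(i < \dim {:subvs_of h}) u i *: (vbasis {:subvs_of h})`_i.
    by exists (fun i => coord (vbasis fullv) i t); rewrite -coord_vbasis ?memvf.
  rewrite !linear_sum lieC linear_sum scaler_suml -sumrN; apply: eq_bigr => i _.
  rewrite -lieC !linearZ /= lieZl -scalerA; congr (_ *: _).
  by apply/eqP; rewrite -kerE; move/memv_bigcap_seq: xb; apply; rewrite mem_nth ?size_tuple.
by apply/memv_bigcap_seq => t _; rewrite kerE xb.
Qed.

End LieBracket.

(** * Lower central series of an ideal spanned by strictly upper triangular units *)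

Section ClassOfNilpotence.
Variables (F : fieldType) (n : nat).
Local Notation gl := 'M[F]_n.+1.
Variables (e : nat -> nat -> gl) (c : F) (l : nat -> nat).
Hypothesis c_neq0 : c != 0.
Hypothesis e_neq0 : forall p q, (p < q <= n)%N -> e p q != 0.
Hypothesis lie_e : forall p q r s, (p < q <= n)%N -> (r < s <= n)%N ->
  lie (e p q) (e r s) = c *: (e p s *+ (q == r) - e r q *+ (s == p)).
Hypothesis l_le : forall i, (l i <= n - i)%N.
Hypothesis l_mono : {homo l : i j / (i <= j)%N >-> (j <= i)%N}.

(** For a row [p < n], the first column [q] with [e p q] among the generators of [I], or [n.+1] if
    the row is empty. *)
Let g p := (n.+1 - l p)%N.

Let I : {vspace gl} := (\sum_(i < n) \sum_(j < l i) <[e i (n - j)]>)%VS.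

(* The span of E m bounds I^(m+1) = lower_central I m from above. *)
Let E m := [seq e p q | p <- iota 0 n.+1,
                        q <- [seq q <- iota 0 n.+1 | (iter m.+1 g p <= q)%N]].

Let g_gt p : (p <= n)%N -> (p < g p)%N.
Proof. by have := l_le p; rewrite /g; lia. Qed.

(** Includes [p = n.+1], the fixed point where the iterates of [g] come to rest. *)
Let g_ge p : (p <= n.+1)%N -> (p <= g p)%N.
Proof. by have := l_le p; rewrite /g; lia. Qed.

Let g_mono : {homo g : p q / (p <= q)%N}.
Proof. by move=> p q /l_mono; rewrite /g; lia. Qed.

Let iter_g_mono m : {homo iter m g : p q / (p <= q)%N}.
Proof. by elim: m => // m IHm p q pq; apply/g_mono/IHm. Qed.

Let iter_g_lt m p q : (p <= n)%N -> (iter m.+1 g p <= q)%N -> (p < q)%N.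
Proof.
move=> pn; apply: leq_trans; apply: leq_trans (g_gt pn) _.
elim: m => //= m IHm; apply: leq_trans IHm _.
exact/g_ge/leq_subr.
Qed.

Let EP m x : reflect (exists p q, [/\ (p < q <= n)%N, (iter m.+1 g p <= q)%N & x = e p q])
                     (x \in E m).
Proof.
apply: (iffP allpairsPdep) => -[p [q [pP qP ->]]].
  exists p, q; split=> //; move: pP qP; rewrite mem_filter !mem_iota !add0n !leq0n /=.
    by move=> pn /andP[pq qn]; rewrite (iter_g_lt _ pq).
  by move=> _ /andP[].
exists p, q; rewrite mem_filter !mem_iota qP; split=> //; lia.
Qed.

Let I_sub : (I <= <<E 0>>)%VS.
Proof.
apply/subv_sumP => i _; apply/subv_sumP => j _; rewrite -memvE memv_span //.
have := l_le i; have := ltn_ord i; have := ltn_ord j => jl i_n li.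
by apply/EP; exists i, (n - j)%N; split=> //=; rewrite /g; lia.
Qed.

Let mem_I p q : (p < q <= n)%N -> (g p <= q)%N -> e p q \in I.
Proof.
move=> /andP[pq qn] gq; have pn : (p < n)%N by exact: leq_trans qn.
have jl : (n - q < l p)%N by move: gq; rewrite /g; lia.
rewrite memvE; apply: (sumv_sup (Ordinal pn)) => //.
by apply: (sumv_sup (Ordinal jl)) => //=; rewrite subKn.
Qed.

(** A bracket joins a unit of [E m] to one of [E 0] at a common index. The bounds compose to
    [iter m.+2 g] by monotonicity, with the extra [g] applied last in the first term and first in
    the second. *)
Let lower_central_sub m : (lower_central I m <= <<E m>>)%VS.
Proof.
elim: m => [|m IHm]; first exact: I_sub.
apply: lie_space_subv => x y /(subvP IHm) xE /(subvP I_sub).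
apply: lie_span_mem xE => _ _ /EP[p [q [pq gq ->]]] /EP[r [s [rs gs ->]]].
rewrite lie_e //; apply/memvZ/memvB.
  have [qr|] := eqVneq q r; last by rewrite mem0v.
  subst r; apply/memv_span/EP; exists p, s; split=> //; first by lia.
  by apply: leq_trans gs; apply: g_mono.
have [sp|] := eqVneq s p; last by rewrite mem0v.
subst s; apply/memv_span/EP; exists r, q; split=> //; first by lia.
by rewrite iterSr; apply: leq_trans gq; apply: iter_g_mono.
Qed.

Let mem_lower_central m q : (iter m.+1 g 0 <= q <= n)%N -> e 0%N q \in lower_central I m.
Proof.
elim: m q => [|m IHm] q /andP[gq qn].
  by apply: mem_I => //; rewrite qn andbT; apply: (@iter_g_lt 0).
(* The pivot [r] is the least column reached in row 0 so far; [r > n] is impossible since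
   [r <= g r <= q <= n]. *)
set r := iter m.+1 g 0; have rq : (r < q)%N.
  have [rn|nr] := leqP r n; first exact: leq_trans (g_gt rn) gq.
  by have := leq_trans (g_ge (leq_subr _ _ : r <= n.+1)%N) gq; lia.
have r0 : (0 < r)%N by apply: (@iter_g_lt m).
(* Only one term of the bracket survives, as [q] is not 0. *)
have -> : e 0%N q = c^-1 *: lie (e 0%N r) (e r q).
  rewrite lie_e; [|lia..]; rewrite eqxx gtn_eqF; last by lia.
  by rewrite subr0 mulr1n scalerK.
apply/memvZ/memv_lie_space; first by apply: IHm; rewrite leqnn; lia.
by apply: mem_I => //; lia.
Qed.

(** At step [k] the bound [n.+1 <= iter k.+1 g p] leaves no admissible column, so [E k] is empty.
    For [m < k], [iter m.+1 g 0 <= iter k g 0 <= n] keeps the nonzero [e 0 n] in the power. *)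
Lemma class_of_nilpotence k :
  (0 < n)%N -> iter k.+1 g 0 = n.+1 -> (iter k g 0 <= n)%N -> nilpotence_class_is I k.
Proof.
move=> n0 gk1 gk; split.
  apply/eqP; rewrite -subv0; apply: subv_trans (lower_central_sub k) _.
  apply/span_subvP => x /EP[p [q [pq gq _]]].
  by have := iter_g_mono k.+1 (leq0n p); rewrite gk1; lia.
move=> m Im0; rewrite leqNgt; apply/negP => mk.
have /mem_lower_central : (iter m.+1 g 0 <= n <= n)%N.
  rewrite leqnn andbT; apply: leq_trans gk; rewrite -(subnKC mk) iterD.
  by apply: iter_g_mono; exact: leq0n.
by rewrite Im0 memv0 (negPf (e_neq0 _)) // n0 leqnn.
Qed.

End ClassOfNilpotence.

(** * Roots of sl(n+1) *)

Section CartanSubalgebra.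
Variables (F : numClosedFieldType) (n : nat).
Local Notation gl := 'M[F]_n.+1.

(** Carries information about [sl] over to all matrices; characteristic 0 permits dividing the trace
    by [n.+1]. *)
Lemma scalar_add_sl (x : gl) : exists2 y, y \in sl F n & exists a, x = y + a%:M.
Proof.
pose a := \tr x / n.+1%:R; exists (x - a%:M); last by exists a; rewrite subrK.
by rewrite mem_sl linearB /= mxtrace_scalar -mulr_natr divfK ?subrr ?pnatr_eq0.
Qed.

(* If v is an eigenvector of t and x one of ad t, then v x is again an
   eigenvector of t or zero; these span F^(n+1), since v gl = F^(n+1). *)
Lemma ad_diagonalizable_diagonalizable (t : gl) : ad_diagonalizable t -> diagonalizable t.
Proof.
move=> [X Xbasis XE].
have [a /eigenvalueP[v vt v0]] := eigenvalue_closed t (ltn0Sn n).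
have {XE} [c cE] : exists c : gl -> F, forall x, x \in X -> lie t x = c x *: x.
  have xP x : exists b, x \in X -> lie t x = b *: x.
    by case: (boolP (x \in X)) => [/XE[b]|]; [exists b|exists 0].
  by have [c cE] := choice xP; exists c.
(* The product [v *m x] has eigenvalue [a - c x], because [v x t = v t x - v [t, x]]; [a] itself
   serves the scalar matrices. *)
pose rs := undup (a :: [seq a - c x | x <- X]).
pose S := (\sum_(r <- rs) eigenspace t r)%MS.
have subS r : r \in rs -> (eigenspace t r <= S)%MS.
  by move=> rrs; rewrite /S (big_rem r) //= addsmxSl.
apply/diagonalizablePeigen; exists rs; first exact: undup_uniq.
apply/eqmxP; rewrite submx1 /=; apply/row_subP => i.
have [j vj] : exists j, v 0 j != 0 by apply/rV0Pn.
(* A nonzero entry [v 0 j] lets [v] be sent to any unit row vector. *)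
have -> : row i 1%:M = v *m ((v 0 j)^-1 *: delta_mx j i).
  rewrite -scalemxAr rowE mulmx1; apply/rowP => k.
  rewrite !mxE (bigD1 j) //= !mxE eqxx big1 ?addr0 /=; last first.
    by move=> j' /negPf j'j; rewrite !mxE j'j mulr0.
  by case: (k == i); rewrite ?mulr0 // mulr1 mulVf.
have [y ys [b ->]] := scalar_add_sl ((v 0 j)^-1 *: delta_mx j i).
rewrite mulmxDr mul_mx_scalar addmx_sub ?scalemx_sub //; last first.
  apply: submx_trans (subS a _); last by rewrite mem_undup mem_head.
  exact/eigenspaceP.
have /coord_span -> : y \in <<in_tuple X>>%VS by rewrite (span_basis Xbasis).
rewrite mulmx_sumr summx_sub // => k _; rewrite -scalemxAr scalemx_sub //.
have kX : X`_k \in X by apply: mem_nth.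
apply: submx_trans (subS (a - c X`_k) _); last first.
  by rewrite mem_undup inE (map_f (fun x => a - c x) kX) orbT.
have Xt : X`_k *m t = t *m X`_k - c X`_k *: X`_k.
  by rewrite -cE // /lie opprB addrC subrK.
apply/eigenspaceP; rewrite -mulmxA Xt.
by rewrite mulmxBr mulmxA vt -scalemxAl -scalemxAr scalerBl.
Qed.

Lemma conjK (P x : gl) : P \in unitmx -> invmx P *m (P *m x *m invmx P) *m P = x.
Proof. by move=> Pu; rewrite -mulmxA mulmxKV // mulKmx. Qed.

Lemma conjVK (P x : gl) : P \in unitmx -> P *m (invmx P *m x *m P) *m invmx P = x.
Proof. by move=> Pu; rewrite -mulmxA mulmxK // mulKVmx. Qed.

Lemma conj_eq0 (P x : gl) : P \in unitmx -> (P *m x *m invmx P == 0) = (x == 0).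
Proof.
move=> Pu; apply/eqP/eqP => [Px|->]; last by rewrite mulmx0 mul0mx.
by rewrite -(conjK x Pu) Px mulmx0 mul0mx.
Qed.

Lemma mxtrace_conj (P x : gl) : P \in unitmx -> \tr (P *m x *m invmx P) = \tr x.
Proof. by move=> Pu; rewrite mxtrace_mulC mulKmx. Qed.

Lemma lie_conj (P x y : gl) : P \in unitmx ->
  P *m lie x y *m invmx P = lie (P *m x *m invmx P) (P *m y *m invmx P).
Proof.
by move=> Pu; rewrite /lie mulmxBr mulmxBl !mulmxA !mulmxKV.
Qed.

(** Commuting diagonalizable matrices are simultaneously diagonalizable. Conversely, a traceless
    matrix diagonal in the same basis commutes with [h], so it lies in [h] by
    self-centralization. *)
Lemma cartan_codiagonalizable (h : {vspace gl}) : is_cartan h -> exists2 P : gl, P \in unitmx &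
  forall x, x \in h <-> (x \in sl F n) && is_diag_mx (P *m x *m invmx P).
Proof.
move=> [hs hC h_max h_ad].
have [P Punit PP] : codiagonalizable (vbasis h).
  apply/codiagonalizableP; split=> [x y xh yh|x xh].
    by apply/lie_eq0/hC; apply: vbasis_mem.
  exact/ad_diagonalizable_diagonalizable/h_ad/vbasis_mem.
have diagP x : x \in h -> is_diag_mx (P *m x *m invmx P).
  move=> /coord_vbasis ->; rewrite mulmx_sumr mulmx_suml; apply/is_diag_mxP => i j ij.
  rewrite summxE big1 // => k _; rewrite -scalemxAr -scalemxAl mxE.
  have /allP/(_ (vbasis h)`_k) := PP; rewrite mem_nth ?size_tuple // => /(_ isT).
  by move/(diagonalizable_forP _ Punit) => /(_ i j ij) ->; rewrite mulr0.
exists P => // x; split=> [xh|/andP[xs xd]]; first by rewrite (subvP hs) ?diagP.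
apply: h_max => // t /diagP td.
apply/eqP; rewrite -(conj_eq0 _ Punit) lie_conj //.
have [d ->] := elimT (diag_mxP _) td; have [d' ->] := elimT (diag_mxP _) xd.
by rewrite /lie diag_mxC subrr.
Qed.

(** * Weights, root vectors and root spaces in a diagonalizing basis *)

Section Weights.
Variables (h : {vspace gl}) (P : gl).
Hypothesis P_unit : P \in unitmx.
Hypothesis hP : forall x,
  x \in h <-> (x \in sl F n) && is_diag_mx (P *m x *m invmx P).
Implicit Types (p q r s : 'I_n.+1) (t : subvs_of h) (b : cartan_dual h).

(** The functional eps_p, a diagonal entry in the basis given by [P]. *)
Definition weight_fun p t : F^o := (P *m vsval t *m invmx P) p p.

Lemma weight_fun_is_linear p : linear (weight_fun p).
Proof.
move=> c t u; rewrite /weight_fun (linearP (@vsval _ _ h)) mulmxDr mulmxDl.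
by rewrite -scalemxAr -scalemxAl !mxE.
Qed.

HB.instance Definition _ p :=
  GRing.isLinear.Build F (subvs_of h) F^o _ (weight_fun p) (weight_fun_is_linear p).

Definition weight p : cartan_dual h := linfun (weight_fun p).

(** The matrix unit E_pq conjugated back from the basis in which [h] is diagonal. *)
Definition root_vector p q : gl := invmx P *m delta_mx p q *m P.

Lemma root_vector_neq0 p q : root_vector p q != 0.
Proof.
rewrite -(conj_eq0 _ P_unit) conjVK //; apply/eqP => /matrixP/(_ p q)/eqP.
by rewrite !mxE !eqxx oner_eq0.
Qed.

Lemma lie_root_vector p q r s : lie (root_vector p q) (root_vector r s) =
  root_vector p s *+ (q == r) - root_vector r q *+ (s == p).
Proof.
have mulE p' q' r' s' : root_vector p' q' *m root_vector r' s' =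
    root_vector p' s' *+ (q' == r').
  rewrite /root_vector -!mulmxA mulKVmx // (mulmxA (delta_mx p' q')) mul_delta_mx_cond.
  by case: (q' == r'); rewrite ?mulr1n ?mulr0n ?mul0mx ?mulmx0.
by rewrite /lie !mulE.
Qed.

Lemma conj_lie_entry t x p q :
  (P *m lie (vsval t) x *m invmx P) p q =
  (weight p t - weight q t) * (P *m x *m invmx P) p q.
Proof.
rewrite lie_conj // !lfunE /= /weight_fun.
have /hP/andP[_ /diag_mxP[d ->]] := subvsP t.
by rewrite /lie mul_diag_mx mul_mx_diag !mxE !eqxx !mulr1n mulrBl [_ * d _ _]mulrC.
Qed.

Lemma root_space_entry b x p q : x \in root_space b ->
  (P *m x *m invmx P) p q != 0 -> b = weight p - weight q.
Proof.
move=> /mem_root_spaceP[_ xb] y0; apply/lfunP => t; apply: (mulIf y0).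
rewrite add_lfunE opp_lfunE -conj_lie_entry xb.
by rewrite -scalemxAr -scalemxAl [RHS]mxE.
Qed.

(* The test element is the coroot E_pp - E_qq; by weight_sub_test2, the root
   eps_p - eps_q is the only one with value 2 on it. *)
Lemma weight_sub_test p q : p != q -> exists t, forall r s,
  (weight r - weight s) t = (r == p)%:R - (r == q)%:R - ((s == p)%:R - (s == q)%:R).
Proof.
move=> pq; pose t := invmx P *m (delta_mx p p - delta_mx q q) *m P.
have th : t \in h.
  have tr_delta p' : \tr (delta_mx p' p' : gl) = 1.
    rewrite /mxtrace (bigD1 p') //= mxE !eqxx big1 ?addr0 // => i ip.
    by rewrite mxE (negPf ip).
  have delta_diag p' : is_diag_mx (delta_mx p' p' : gl).
    apply/is_diag_mxP => i j ij; rewrite mxE; case: eqP => // ip; case: eqP => // jp.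
    by rewrite ip jp eqxx in ij.
  apply/hP; rewrite mem_sl -(mxtrace_conj _ P_unit) conjVK // linearB /=.
  rewrite !tr_delta subrr eqxx; apply/is_diag_mxP => i j ij.
  by rewrite [LHS]mxE [X in _ + X]mxE !(is_diag_mxP (delta_diag _)) // subrr.
exists (vsproj h t) => r s.
rewrite add_lfunE opp_lfunE !lfunE /= /weight_fun vsprojK // conjVK //.
by rewrite !mxE !andbb.
Qed.

(** Moving the negative terms across gives an equation of natural numbers, valid as such in
    characteristic 0: the side that is at least 2 equals a sum of two indicators, so both are 1. *)
Lemma weight_sub_test2 p q r s : p != q ->
  (r == p)%:R - (r == q)%:R - ((s == p)%:R - (s == q)%:R) = 2%:R :> F -> r = p /\ s = q.
Proof.
move=> pq rs2.
have : ((2 + (r == q) + (s == p))%N%:R == ((r == p) + (s == q))%N%:R :> F).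
  by rewrite !natrD -rs2; apply/eqP; ring.
rewrite eqr_nat.
by have [->|] := eqVneq r p; have [->|] := eqVneq s q; case: (r == q); case: (s == p).
Qed.

Lemma weight_sub_inj p q r s : p != q -> weight p - weight q = weight r - weight s ->
  r = p /\ s = q.
Proof.
move=> pq; have [t tE] := weight_sub_test pq => /lfunP/(_ t).
rewrite !tE !eqxx (negPf pq) eq_sym (negPf pq) => tpq.
by apply: weight_sub_test2 => //; rewrite -tpq /=; ring.
Qed.

(** A nonzero entry at [(r, s)] would give the root as eps_r - eps_s, and a root determines its pair
    of indices; hence only the entry [(p, q)] can survive. *)
Lemma root_spaceE p q : p != q ->
  root_space (weight p - weight q) = <[root_vector p q]>%VS.
Proof.
move=> pq; apply/eqP; rewrite eqEsubv -memvE; apply/andP; split; last first.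
  apply/mem_root_spaceP; split=> [|t].
    rewrite mem_sl -(mxtrace_conj _ P_unit) conjVK // /mxtrace big1 // => i _.
    by rewrite mxE; case: eqP => // ->; rewrite (negPf pq).
  apply/eqP; rewrite -subr_eq0 -(conj_eq0 _ P_unit) mulmxBr mulmxBl; apply/eqP.
  apply/matrixP => r s; rewrite [LHS]mxE [X in _ + X]mxE conj_lie_entry.
  rewrite -scalemxAr -scalemxAl conjVK // [X in _ - X]mxE !mxE add_lfunE opp_lfunE.
  case: eqP => [->|_]; last by rewrite !mulr0 subrr.
  by case: eqP => [->|_]; rewrite ?mulr0 subrr.
apply/subvP => x xb; apply/vlineP; exists ((P *m x *m invmx P) p q).
rewrite /root_vector scalemxAl scalemxAr -[LHS](conjK x P_unit); congr (_ *m _ *m _).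
have yE r s : (P *m x *m invmx P) r s != 0 -> r = p /\ s = q.
  by move=> /(root_space_entry xb)/(weight_sub_inj pq).
move: (P *m x *m invmx P) yE => y yE; apply/matrixP => r s; rewrite !mxE.
have [y0|/yE[-> ->]] := eqVneq (y r s) 0; last by rewrite !eqxx mulr1.
by rewrite y0; case: eqP => [<-|]; case: eqP => [<-|]; rewrite ?mulr0 // y0 mul0r.
Qed.

Lemma weight_sub_eq0 p q : (weight p - weight q == 0) = (p == q).
Proof.
apply/idP/idP => [pq0|/eqP->]; last by rewrite subrr.
apply: contraTT pq0 => pq; have [t tE] := weight_sub_test pq.
apply/eqP => /lfunP/(_ t); rewrite tE zero_lfunE !eqxx (negPf pq) eq_sym (negPf pq).
by rewrite subr0 sub0r opprK => /eqP; rewrite -(natrD _ 1 1) pnatr_eq0.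
Qed.

Lemma is_rootP b : is_root b <-> exists p q, p != q /\ b = weight p - weight q.
Proof.
split=> [/andP[b0 rb]|[p [q [pq ->]]]]; last first.
  rewrite /is_root weight_sub_eq0 pq root_spaceE //= -subv0 -memvE memv0.
  exact: root_vector_neq0.
have [x xb] : exists2 x, x \in root_space b & x != 0.
  by exists (vpick (root_space b)); rewrite ?memv_pick ?vpick0.
rewrite -(conj_eq0 _ P_unit) => /eqP y0.
have [p [q ypq]] : exists p q, (P *m x *m invmx P) p q != 0.
  apply: contra_notP y0 => yP; apply/matrixP => p q; rewrite [RHS]mxE.
  by apply/eqP/negP => /negP ypq; case: yP; exists p, q.
have bE := root_space_entry xb ypq; exists p, q; split=> //.
by apply: contraNneq b0 => pq; rewrite bE pq subrr.
Qed.

(** * Simple systems as paths through the indices *)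

Section SimpleSystem.
Variable a : n.-tuple (cartan_dual h).
Hypotheses (a_simple : is_simple_system a) (a_dynkin : numbered_along_dynkin a).

Lemma simple_free (c : nat -> F) i :
  \sum_(0 <= k < n) c k *: a`_k = 0 -> (i < n)%N -> c i = 0.
Proof.
have [a_basis _ _] := a_simple; rewrite big_mkord => sum0 i_n.
by move/freeP: (basis_free a_basis) => /(_ (fun k : 'I_n => c k) sum0 (Ordinal i_n)).
Qed.

Lemma simple_delta i : (i < n)%N -> a`_i = \sum_(0 <= k < n) (k == i)%:R *: a`_k.
Proof.
move=> i_n; rewrite big_mkord (bigD1 (Ordinal i_n)) //= eqxx scale1r big1 ?addr0 //.
by move=> k /negPf ki; rewrite (ki : _ == _ :> nat = false) scale0r.
Qed.

Lemma nonneg_comb_simple_sub i j : (i < n)%N -> (j < n)%N -> i != j ->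
  ~ nonneg_comb a (a`_i - a`_j).
Proof.
move=> i_n j_n ij [c cE].
pose c' k := if insub k is Some k' then c k' else 0%N.
have c'E : \sum_(k < n) a`_k *+ c k = \sum_(0 <= k < n) (c' k)%:R *: a`_k.
  by rewrite big_mkord; apply: eq_bigr => k _; rewrite /c' valK scaler_nat.
have := @simple_free (fun k => (k == i)%:R - (k == j)%:R - (c' k)%:R) j.
rewrite eqxx eq_sym (negPf ij) sub0r => /(_ _ j_n).
have -> : \sum_(0 <= k < n) ((k == i)%:R - (k == j)%:R - (c' k)%:R) *: a`_k = 0.
  rewrite -[RHS](subrr (a`_i - a`_j)) [X in _ - X]cE c'E (simple_delta i_n) (simple_delta j_n).
  by rewrite -!sumrB; apply: eq_bigr => k _; rewrite !scalerBl.
by move=> /(_ erefl)/eqP; rewrite -opprD oppr_eq0 -(natrD _ 1) pnatr_eq0.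
Qed.

Lemma simple_sub_not_root i j : (i < n)%N -> (j < n)%N -> i != j ->
  ~ is_root (a`_i - a`_j).
Proof.
move=> i_n j_n ij; have [_ _ a_pos] := a_simple => /a_pos[].
  exact: nonneg_comb_simple_sub.
by rewrite opprB; apply: nonneg_comb_simple_sub; rewrite // eq_sym.
Qed.

(** Serves to show that the vertices of the path are distinct: these sums telescope to differences
    of weights at two vertices. *)
Lemma simple_sum_neq0 i j : (i < j <= n)%N -> \sum_(i <= k < j) a`_k != 0.
Proof.
move=> /andP[ij jn]; apply/eqP => sum0.
suff : (i <= i < j)%:R = 0 :> F by move/eqP; rewrite leqnn ij oner_eq0.
apply: (@simple_free (fun k => (i <= k < j)%:R)); last exact: leq_trans ij jn.
rewrite -[RHS]sum0 (big_nat_widenl _ _ _ _ _ (leq0n i)) (big_nat_widen _ _ _ _ _ jn).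
rewrite [RHS]big_mkcond; apply: eq_bigr => k _ /=.
by rewrite andbC; case: (_ && _); rewrite ?scale1r ?scale0r.
Qed.

Lemma simple_roots_endpoints : exists p q : nat -> 'I_n.+1,
  forall i, (i < n)%N -> p i != q i /\ a`_i = weight (p i) - weight (q i).
Proof.
have [_ a_root _] := a_simple.
have /choice[f fE] : forall i, exists pq : 'I_n.+1 * 'I_n.+1, (i < n)%N ->
    pq.1 != pq.2 /\ a`_i = weight pq.1 - weight pq.2.
  move=> i; have [i_n|_] := ltnP i n; last by exists (ord0, ord0).
  have /a_root/is_rootP[p [q pq]] : a`_i \in a by rewrite mem_nth ?size_tuple.
  by exists (p, q).
by exists (fun i => (f i).1), (fun i => (f i).2).
Qed.

(* Consecutive simple roots share an endpoint because their sum is a root, and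
   never both leave or both enter it because their difference is not a root. *)
Lemma simple_roots_path : exists v : nat -> 'I_n.+1,
  (forall i, (i < n)%N -> a`_i = weight (v i) - weight (v i.+1)) \/
  (forall i, (i < n)%N -> a`_i = weight (v i.+1) - weight (v i)).
Proof.
have [p [q pqE]] := simple_roots_endpoints.
have aE i : (i < n)%N -> a`_i = weight (p i) - weight (q i) by case/pqE.
have pq i : (i < n)%N -> p i != q i by case/pqE.
have p_inj i j : (i < n)%N -> (j < n)%N -> i != j -> p i != p j.
  move=> i_n j_n ij; apply: contra_notN (simple_sub_not_root i_n j_n ij) => /eqP pij.
  apply/is_rootP; exists (q j), (q i).
  rewrite !aE // pij opprB addrC addrA subrK; split=> //.
  (* If both endpoints agreed, the difference would be 0, the empty nonnegative combination. *)
  apply/eqP => qij.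
  have := nonneg_comb_simple_sub i_n j_n ij; rewrite !aE // pij qij subrr; apply.
  by exists (fun=> 0%N); rewrite big1.
have q_inj i j : (i < n)%N -> (j < n)%N -> i != j -> q i != q j.
  move=> i_n j_n ij; apply: contra_notN (simple_sub_not_root i_n j_n ij) => /eqP qij.
  apply/is_rootP; exists (p i), (p j); rewrite p_inj //; split=> //.
  by rewrite !aE // qij opprB addrA subrK.
have adj i : (i.+1 < n)%N -> q i = p i.+1 \/ p i = q i.+1.
  move=> i_n; have i_n' := ltnW i_n.
  have := @a_dynkin i i.+1; rewrite ltnSn i_n eqxx => /(_ isT)/is_rootP[r [s [rs]]].
  have [->|pi] := eqVneq (p i) (q i.+1); first by right.
  have [->|qi] := eqVneq (q i) (p i.+1); first by left.
  have [t tE] := weight_sub_test (pq _ i_n').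
  rewrite !aE // => sumE; have /lfunP/(_ t) := sumE.
  rewrite [LHS]add_lfunE !tE !eqxx (negPf (pq _ _)) // (negPf (p_inj _ _ _ _ _)) //; try lia.
  rewrite (negPf (q_inj _ _ _ _ _)) //; try lia.
  rewrite ![q _ == p _]eq_sym (negPf (pq _ _)) // (negPf pi).
  rewrite [p i.+1 == _]eq_sym (negPf qi) => t2.
  have [rE sE] : r = p i /\ s = q i.
    by apply: weight_sub_test2 => //; [exact: pq|rewrite -t2 /=; ring].
  move: sumE; rewrite rE sE => /(canRL (addKr _)); rewrite addNr => /eqP.
  by rewrite weight_sub_eq0 (negPf (pq _ _)).
(* The starting endpoint of the first root, followed by the far endpoint of each root in turn. *)
pose path v w := fun i => if i is j.+1 then w j else v 0%N : 'I_n.+1.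
have [n1|n1] := leqP n 1.
  by exists (path p q); left=> -[|i] i_n; [exact: aE|lia].
case: (adj 0%N n1) => [q0|p0].
  (* The first pair fixes the direction; a reversal later would give two simple roots the same
     endpoint [q]. *)
  have fwd i : (i.+1 < n)%N -> q i = p i.+1.
    elim: i => // i IHi i_n; case: (adj _ i_n) => // /esym.
    by move/eqP; rewrite -IHi ?(ltnW i_n) // (negPf (q_inj _ _ _ _ _)) //; lia.
  exists (path p q); left=> -[|i] i_n; first exact: aE.
  by rewrite [RHS]/= (fwd i) // aE.
have bwd i : (i.+1 < n)%N -> p i = q i.+1.
  elim: i => // i IHi i_n; case: (adj _ i_n) => // /esym.
  by move/eqP; rewrite -IHi ?(ltnW i_n) // (negPf (p_inj _ _ _ _ _)) //; lia.
exists (path q p); right=> -[|i] i_n; first exact: aE.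
by rewrite [RHS]/= (bwd i) // aE.
Qed.

Lemma sum_weight_path (f : nat -> cartan_dual h) i j : (i <= j <= n)%N ->
  (forall k, (k < n)%N -> a`_k = f k - f k.+1) -> \sum_(i <= k < j) a`_k = f i - f j.
Proof.
move=> /andP[ij jn] aE; rewrite -opprB -telescope_sumr // -sumrN.
by apply: eq_big_nat => k /andP[_ kj]; rewrite aE ?opprB // (leq_trans kj).
Qed.

(* The root vectors can be indexed so that tau i j is the weight of e i (n - j);
   the sign c is -1 if the simple roots run backwards along the path. *)
Lemma root_vectors_of_simple_system : exists (e : nat -> nat -> gl) (c : F), [/\ c != 0,
  forall p q : nat, (p < q <= n)%N -> e p q != 0,
  forall p q r s : nat, (p < q <= n)%N -> (r < s <= n)%N ->
    lie (e p q) (e r s) = c *: (e p s *+ (q == r) - e r q *+ (s == p)) &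
  forall i j, (i + j < n)%N -> root_space (tau a i j) = <[e i (n - j)%N]>%VS].
Proof.
have [v vE] := simple_roots_path.
have v_lt i j : (i < j <= n)%N -> v i != v j.
  move=> ij; apply: contraNneq (simple_sum_neq0 ij) => vij.
  have ij' : (i <= j <= n)%N by lia.
  case: vE => vE; first by rewrite (sum_weight_path ij' vE) vij subrr.
  (* Negating the weights turns a backward path into a forward one. *)
  rewrite (@sum_weight_path (fun k => - weight (v k)) _ _ ij').
    by rewrite vij subrr.
  by move=> k kn; rewrite vE // opprK addrC.
have v_inj i j : (i <= n)%N -> (j <= n)%N -> (v i == v j) = (i == j).
  move=> i_n j_n; have [ij|ji|->] := ltngtP i j; last by rewrite eqxx.
    by apply/negbTE/v_lt; lia.
  by rewrite eq_sym; apply/negbTE/v_lt; lia.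
case: vE => vE.
  exists (fun p q : nat => root_vector (v p) (v q)), 1; split=> [|p q _|p q r s pq rs|i j ij].
  - exact: oner_neq0.
  - exact: root_vector_neq0.
  - by rewrite scale1r lie_root_vector !v_inj; [|lia..].
  - rewrite /tau (@sum_weight_path (fun k => weight (v k))) ?root_spaceE ?v_lt //; lia.
(* Transposed units multiply in the opposite order, whence the sign. *)
exists (fun p q : nat => root_vector (v q) (v p)), (-1); split=> [|p q _|p q r s pq rs|i j ij].
- by rewrite oppr_eq0 oner_neq0.
- exact: root_vector_neq0.
- have [pn qn] : (p <= n)%N /\ (q <= n)%N by lia.
  have [rn sn] : (r <= n)%N /\ (s <= n)%N by lia.
  by rewrite scaleN1r opprB lie_root_vector !v_inj // (eq_sym p) (eq_sym r).
- rewrite /tau (@sum_weight_path (fun k => - weight (v k))); try lia; last first.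
    by move=> k kn; rewrite vE // opprK addrC.
  rewrite opprK addrC root_spaceE // eq_sym v_lt //; lia.
Qed.

End SimpleSystem.

End Weights.

(** * The class of an ideal read off from its chain *)

Lemma corresponds_nilpotence_class (h : {vspace gl}) (a : n.-tuple (cartan_dual h))
    (I : {vspace gl}) (l : nat -> nat) (k : nat) (s : seq nat) : (0 < n)%N ->
  is_cartan h -> is_simple_system a -> numbered_along_dynkin a -> corresponds a I l ->
  chains n k s -> young_itv (lambda_min n s) (lambda_max n s) l ->
  nilpotence_class_is I k.
Proof.
move=> n0 /cartan_codiagonalizable[P P_unit hP] a_simple a_dynkin.
move=> [[lP _ l_stair] ->] [sk sP] /(young_itvP sP lP) lE.
have [e [c [c0 e0 lie_e tauE]]] :=
  root_vectors_of_simple_system P_unit hP a_simple a_dynkin.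
have l_le i : (l i <= n - i)%N by rewrite -(nth_staircase n).
have -> : (\sum_(i < n) \sum_(j < l i) root_space (tau a i j) =
           \sum_(i < n) \sum_(j < l i) <[e i (n - j)%N]>)%VS.
  apply: eq_bigr => i _; apply: eq_bigr => j _; rewrite tauE //.
  by have := l_le i; have := ltn_ord i; have := ltn_ord j; lia.
have l_mono := partition_nonincreasing lP.
have iterE j : (j <= k.+1)%N ->
    iter j (fun p => n.+1 - l p)%N 0%N = (n.+1 - idx n s (k.+1 - j))%N.
  elim: j => [_|j IHj jk]; first by rewrite subn0 -sk idxk1 // subnn.
  by rewrite iterS IHj ?(ltnW jk) // (@subSn j k jk) lE ?subSS // sk leq_subr.
(* The iterates end at [n.+1 - idx 0 = n.+1]; one step earlier the value is [n.+1 - idx 1], at most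
   [n] as [idx 1] is positive. *)
apply: (class_of_nilpotence c0 e0 lie_e l_le l_mono n0).
  by rewrite iterE // subnn idx0 subn0.
by rewrite iterE // subSnn; have := @idx_gt0 _ _ sP 1%N isT; lia.
Qed.

End CartanSubalgebra.

Theorem proposition4p1 (n : nat) (hn : (1 <= n)%N) :
  ((forall k s, (k <= n)%N -> chains n k s ->
      [/\ is_partition (nth 0%N (lambda_min n s)),
          is_partition (nth 0%N (lambda_max n s))
        & young_le (nth 0%N (lambda_min n s)) (nth 0%N (lambda_max n s))]) /\
   young_itv (nseq n 0%N) (staircase n) =
     \bigcup_(k in [set k : nat | (k <= n)%N]) \bigcup_(s in chains n k)
       young_itv (lambda_min n s) (lambda_max n s) /\
   trivIset (\bigcup_(k in [set k : nat | (k <= n)%N]) chains n k)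
     (fun s => young_itv (lambda_min n s) (lambda_max n s)))
  /\
  (forall (R : realType) (h : {vspace 'M[R[i]]_n.+1})
      (a : n.-tuple (cartan_dual h)) (b I : {vspace 'M[R[i]]_n.+1})
      (l : nat -> nat) (k : nat) (s : seq nat),
    is_cartan h -> is_simple_system a -> numbered_along_dynkin a ->
    is_borel a b ->
    is_ad_nilpotent_ideal b I -> corresponds a I l ->
    (k <= n)%N -> chains n k s ->
    young_itv (lambda_min n s) (lambda_max n s) l ->
    nilpotence_class_is I k).

Proof.
split; last first.
  move=> R h a b I l k s h_cartan a_simple a_dynkin _ _ Il _ sP.
  exact: corresponds_nilpotence_class h_cartan a_simple a_dynkin Il sP.
split; last by split; [exact: young_itv_decomposition|exact: young_itv_trivIset].
move=> k s _ [_ sP]; split.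
- exact: lambda_min_partition.
- exact: lambda_max_partition.
- exact: young_le_lambda.
Qed.
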